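(* Let $s\ge 1$ be an integer and fix the constant $c>0$ in the definition of $\mathcal{S}_{2,s}^*(\mathbb{Z};H)$ given in the context. Then, as $H\to\infty$, $$\#\mathcal{S}_{2,s}^*(\mathbb{Z};H)\gg\begin{cases}H^{s+o(1)},&\text{if } s \text{ is even},\\ H^{s-1},&\text{if } s\text{ is odd},\end{cases}$$ where the implied constant depends on $s$ (and $c$). That is: if $s$ is even, then for every $\varepsilon>0$ there are $C>0$ and $H_0$ depending only on $s,c,\varepsilon$ with $\#\mathcal{S}_{2,s}^*(\mathbb{Z};H)\ge C H^{s-\varepsilon}$ for all $H\ge H_0$; if $s$ is odd, then there are $C>0$ and $H_0$ depending only on $s,c$ with $\#\mathcal{S}_{2,s}^*(\mathbb{Z};H)\ge C H^{s-1}$ for all $H\ge H_0$.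
   Context: For a $(2\times 2)$-matrix $A=(a_{ij})$ with integer entries, $\mathcal{H}(A)=\max(1,\max_{i,j}|a_{ij}|)$ is the multiplicative height of the projective point $(1:a_{11}:a_{12}:a_{21}:a_{22})$. $\mathcal{S}_2(\mathbb{Z};H)$ is the set of symmetric $(2\times 2)$-matrices $A$ with integer entries, $\det A\neq 0$ and $\mathcal{H}(A)\le cH$, where $c>0$ is a fixed constant (the paper writes $\mathcal{H}(A)\ll H$). A tuple $(A_1,\ldots,A_t)$ of invertible matrices is multiplicatively dependent if there are integers $(k_1,\ldots,k_t)\ne(0,\ldots,0)$ with $A_1^{k_1}\cdots A_t^{k_t}=I_2$. $\mathcal{S}_{2,s}^*(\mathbb{Z};H)$ is the set of multiplicatively dependent $s$-tuples of matrices from $\mathcal{S}_2(\mathbb{Z};H)$ such that no subtuple (i.e. $t$-tuple with $1\le t<s$ arising by cancelling components, keeping the order) is multiplicatively dependent. *)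

(* Defs.v *)
From mathcomp Require Import all_boot all_order all_algebra.
From mathcomp Require Import finmap.
From mathcomp Require Import boolp classical_sets functions cardinality.
From mathcomp Require Import reals exp.

Set Implicit Arguments.
Unset Strict Implicit.
Unset Printing Implicit Defensive.

Import Order.TTheory GRing.Theory Num.Theory.

Local Open Scope classical_set_scope.
Local Open Scope ring_scope.

Definition height (A : 'M[int]_2) : nat :=
  maxn 1 (\max_(i < 2) \max_(j < 2) `|A i j|%N).

Definition sym_mx (R : realType) (c H : R) : set 'M[int]_2 :=
  [set A | [/\ A^T = A, \det A != 0 & (height A)%:R <= c * H]].

(* The inverse of an integer matrix need not be integral, so powers with
   negative exponents are taken in 'M[rat]_2.  The product over 'I_t is taken
   in increasing order of the index. *)
Definition mult_dependent (t : nat) (A : 'I_t -> 'M[int]_2) : Prop :=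
  exists k : 'I_t -> int,
    (exists i, k i != 0) /\
    \prod_(i < t) (map_mx intr (A i) : 'M[rat]_2) ^ k i = 1.

(* A proper subtuple is the composite of the tuple with a strictly increasing
   selection of 0 < t < s of its indices. *)
Definition min_mult_dependent (s : nat) (A : 'I_s -> 'M[int]_2) : Prop :=
  mult_dependent A /\
  forall (t : nat) (f : 'I_t -> 'I_s), (0 < t < s)%N ->
    {homo f : i j / (i < j)%N} -> ~ mult_dependent (A \o f).

Definition sym_star (R : realType) (s : nat) (c H : R) :
    set (s.-tuple 'M[int]_2) :=
  [set A | (forall i, sym_mx c H (tnth A i)) /\ min_mult_dependent (tnth A)].

(* [fset_set] sends infinite sets to [fset0]; this shows that its cardinal is
   the actual number of elements here. *)
Lemma finite_sym_star (R : realType) (s : nat) (c H : R) :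
  finite_set (@sym_star R s c H).
Proof.
have [N leN] : exists N : nat, c * H <= N%:R.
  exists (Num.bound `|c * H|).
  exact: le_trans (ler_norm _) (ltW (archi_boundP (normr_ge0 _))).
pose g (B : s.-tuple 'M['I_(N + N).+1]_2) : s.-tuple 'M[int]_2 :=
  [tuple of map (map_mx (fun x : 'I_(N + N).+1 => x%:Z - N%:Z)) B].
apply: (@sub_finite_set _ _ (g @` [set: _])); last exact/finite_image/finite_finset.
move=> A [SA _].
exists [tuple of map (map_mx (fun z : int => inord (absz (z + N%:Z)))) A] => //.
apply: eq_from_tnth => i; rewrite !tnth_map; apply/matrixP => a b; rewrite !mxE.
have [_ _ hA] := SA i.
have : (`|tnth A i a b| <= N)%N.
  rewrite -(ler_nat R); apply: le_trans leN; apply: le_trans hA.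
  rewrite ler_nat /height (leq_trans _ (leq_maxr _ _))//.
  apply: leq_trans (leq_bigmax a).
  exact: (leq_bigmax (F := fun j => `|tnth A i a j|%N)).
move: (tnth A i a b) => z hz.
have z0 : 0 <= z + N%:Z by rewrite -lerBlDr sub0r lerNl (le_trans (ler_norm _))// normrN -abszE lez_nat.
rewrite inordK.
  by rewrite gez0_abs// addrK.
rewrite ltnS -lez_nat gez0_abs// PoszD lerD2r.
by rewrite (le_trans (ler_norm _))// -abszE lez_nat.
Qed.

Definition num_sym_star (R : realType) (s : nat) (c H : R) : nat :=
  #|` fset_set (@sym_star R s c H)|%fset.

(* Main.v *)
Require Import Defs.
From mathcomp Require Import all_boot all_order all_algebra.
From mathcomp Require Import finmap.
From mathcomp Require Import boolp classical_sets cardinality.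
From mathcomp Require Import reals exp zify ring.

(** Two diagonal matrices contribute two free integers, and a relation between
scalars can be spread over pairs of matrices that share the same diagonal
matrix.  Take diagonal matrices P_0, P_1, ... and nonzero integers
u_0, u_1, ..., and let A_l be u_{(l+1)/2} P_{l/2} (both indices rounded down), so
that the tuple reads
   u_0 P_0, u_1 P_0, u_1 P_1, u_2 P_1, u_2 P_2, ...
In A_0 A_1^-1 A_2 A_3^-1 ... each P_i cancels and the scalars telescope.  With
u_0 = 1, and with the last u (if s is even) or the last P (if s is odd) trivial,
the product is the identity: [prod_chain_eq1].

For the minimality, the choices are such that any two neighbours A_j and
A_{j+1} have a prime r_j in common: it divides det A_j and det A_{j+1} to the
same positive order, and divides no other determinant of the tuple.  For odd j
this prime is the common factor u_{(j+1)/2}; for even j it is a prescribed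
divisor of det P_{j/2}.  Taking determinants and then r_j-adic valuations in a
relation with exponents k_l gives k_j + k_{j+1} = 0 for all j.  Hence all
exponents have the same absolute value, and a relation that omits one of the
matrices is trivial: [path_min_dependent].

Finally r_{2i} divides det P_i, and the other r_j do not, as soon as
P_i = diag(r_{2i} + Q x, 1 + Q y), where Q is the product of the r_j.  The
r_j and Q depend on s only, so the 2 floor(s/2) parameters x, y range freely
over an interval of length proportional to H.  Distinct parameters give
distinct tuples, so there are at least C H^(2 floor(s/2)) of them
([num_sym_star_asymp]).  The exponent is s for even s and s - 1 for odd s. *)

Set Implicit Arguments.
Unset Strict Implicit.
Unset Printing Implicit Defensive.

Import Order.TTheory GRing.Theory Num.Theory.

Local Open Scope ring_scope.

(** * Relations and determinant valuations *)

Lemma logn_prod (I : Type) (r : seq I) (p : nat) (F : I -> nat) :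
  (forall i, (0 < F i)%N) ->
  logn p (\prod_(i <- r) F i)%N = (\sum_(i <- r) logn p (F i))%N.
Proof.
move=> F_gt0.
suff [] : (0 < \prod_(i <- r) F i)%N /\
  logn p (\prod_(i <- r) F i)%N = (\sum_(i <- r) logn p (F i))%N by [].
elim/big_rec2: _ => [|i y x _ [y_gt0 <-]]; first by rewrite logn1.
by rewrite muln_gt0 F_gt0 y_gt0 lognM.
Qed.

(** Unique factorization turns a multiplicative relation between integers into
an additive one between their valuations. *)
Lemma logn_relation (n : nat) (d : 'I_n -> int) (k : 'I_n -> int) (p : nat) :
  (forall i, d i != 0) -> \prod_(i < n) ((d i)%:~R : rat) ^ k i = 1 ->
  \sum_(i < n) k i * (logn p `|d i|)%:Z = 0.
Proof.
move=> d_neq0 prod1.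
(* Moving the negative exponents to the other side makes the relation an
   equality of integers. *)
pose kp i := if 0 <= k i then `|k i|%N else 0%N.
pose kn i := if 0 <= k i then 0%N else `|k i|%N.
have kE i : k i = (kp i)%:Z - (kn i)%:Z by rewrite /kp /kn; case: ifP; lia.
have dX : \prod_(i < n) d i ^+ kp i = \prod_(i < n) d i ^+ kn i.
  apply: (@intr_inj rat); rewrite !rmorph_prod /=.
  rewrite -[RHS]mul1r -[X in _ = X * _]prod1 -big_split; apply: eq_bigr => i _ /=.
  have di : (d i)%:~R != 0 :> rat by rewrite intr_eq0.
  by rewrite !rmorphXn /= kE !exprnP -expfzDr// subrK.
have d_gt0 (e : 'I_n -> nat) i : (0 < `|d i| ^ e i)%N.
  by rewrite expn_gt0 absz_gt0 d_neq0.
have lognE e : logn p `|\prod_(i < n) d i ^+ e i| =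
    (\sum_(i < n) e i * logn p `|d i|)%N.
  rewrite (big_morph absz abszM absz1).
  under eq_bigr do rewrite abszX.
  by rewrite logn_prod//; apply: eq_bigr => i _; rewrite lognX.
under eq_bigr do rewrite kE mulrBl -!PoszM.
by rewrite sumrB -!(big_morph Posz PoszD (erefl _)) -!lognE dX subrr.
Qed.

Lemma det_relation (n m : nat) (A : 'I_n -> 'M[int]_m.+1) (k : 'I_n -> int) (p : nat) :
  (forall i, \det (A i) != 0) ->
  \prod_(i < n) (map_mx intr (A i) : 'M[rat]_m.+1) ^ k i = 1 ->
  \sum_(i < n) k i * (logn p `|\det (A i)|)%:Z = 0.
Proof.
move=> detA prod1; apply: logn_relation => //.
have := congr1 determinant prod1; rewrite det1 => detE; rewrite -[RHS]detE.
rewrite (big_morph _ (@det_mulmx _ _) (@det1 _ _)).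
apply: eq_bigr => i _.
have uA : \det (map_mx intr (A i) : 'M[rat]_m.+1) != 0.
  by rewrite det_map_mx intr_eq0.
have detX (j : nat) : \det ((map_mx intr (A i) : 'M[rat]_m.+1) ^+ j) = (\det (A i))%:~R ^+ j.
  elim: j => [|j IH]; first by rewrite !expr0 det1.
  by rewrite !exprS det_mulmx IH det_map_mx.
case: (k i) => j; first by rewrite -!exprnP detX.
by rewrite !NegzE -!exprnN det_inv detX.
Qed.

(** The minimality criterion.  The prime [r j] links the neighbours [j] and
[j.+1] and sees nothing else, so that a relation has opposite exponents at [j]
and [j.+1]; if an exponent vanishes, then so do all of them. *)
Lemma path_min_dependent (s : nat) (A : 'I_s -> 'M[int]_2) (r : nat -> nat) :
  (forall l, \det (A l) != 0) ->
  (forall j, (j.+1 < s)%N -> exists2 w, (0 < w)%N &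
     forall l : 'I_s, logn (r j) `|\det (A l)| =
       (w * ((l == j :> nat) || (l == j.+1 :> nat)))%N) ->
  mult_dependent A -> min_mult_dependent A.
Proof.
move=> detA vA depA; split=> // t f /andP[t_gt0 lt_ts] f_incr [k [[i0 ki0]]].
have f_inj : injective f.
  move=> i j fij; apply: val_inj => /=.
  by have [/f_incr|/f_incr|//] := ltngtP i j; rewrite fij ltnn.
move=> prod1.
(* [K] is the family of exponents of the subtuple, extended by zero to the
   whole tuple. *)
pose K l : int := \sum_(i < t | f i == l) k i.
have KE i : K (f i) = k i.
  by rewrite /K (bigD1 i)//= big1 ?addr0// => j /andP[/eqP/f_inj -> /eqP].
have step (j j' : 'I_s) : j' = j.+1 :> nat -> K j + K j' = 0.
  move=> j'E; have ltj : (j.+1 < s)%N by rewrite -j'E.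
  have [w w_gt0 vj] := vA j ltj.
  have := det_relation (r j) (fun i => detA (f i)) prod1.
  under eq_bigr do rewrite /= vj.
  rewrite (partition_big f xpredT)//=.
  have -> : \sum_(l < s) \sum_(i < t | f i == l)
      k i * (w * ((f i == j :> nat) || (f i == j.+1 :> nat)))%N%:Z =
      \sum_(l < s) K l * (w * ((l == j) || (l == j')))%N%:Z.
    apply: eq_bigr => l _; rewrite /K big_distrl/=.
    by apply: eq_bigr => i /eqP ->; rewrite -j'E.
  have j'j : j' != j by rewrite -val_eqE /= j'E; lia.
  rewrite (bigD1 j)//= (bigD1 j')//= big1; last first.
    by move=> l /andP[/negPf -> /negPf ->]; rewrite muln0 mulr0.
  rewrite !eqxx orbT muln1 addr0 -mulrDl => /eqP.
  by rewrite mulf_eq0 (gtn_eqF w_gt0 : (w%:Z == 0) = false) orbF => /eqP.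
have s_gt0 : (0 < s)%N by lia.
have absK (l : 'I_s) : `|K l|%N = `|K (Ordinal s_gt0)|%N.
  case: l; elim=> [|l IH] ltl; first by congr `|K _|%N; exact: val_inj.
  have ltl' : (l < s)%N by lia.
  by rewrite -(IH ltl'); have := step (Ordinal ltl') (Ordinal ltl) erefl; lia.
have : [exists l, l \notin codom f].
  rewrite -negb_forall; apply/negP => /forallP f_surj.
  have : (#|'I_s| <= #|codom f|)%N by apply/subset_leq_card/fintype.subsetP => l _.
  by rewrite (card_codom f_inj) !card_ord; lia.
case/existsP => l l_f.
have Kl : K l = 0.
  by rewrite /K big_pred0// => i; apply: contraNF l_f => /eqP <-; exact: codom_f.
by move: ki0; rewrite -KE -absz_eq0 absK -(absK l) Kl.
Qed.

(** * The alternating relation *)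

Lemma prod_telescope (F : fieldType) (M : unitAlgType F) (u : nat -> F) (P : nat -> M) (i : nat) :
  (forall j, u j != 0) -> (forall j, P j \is a GRing.unit) ->
  \prod_(l < i.*2) (u (uphalf l) *: P l./2) ^ ((-1) ^+ l : int) = (u 0%N / u i)%:A.
Proof.
move=> u_neq0 uP; elim: i => [|i IH]; first by rewrite big_ord0 divff// scale1r.
have uh : uphalf i.*2.+1 = i.+1 by rewrite uphalf_half /= odd_double uphalf_double.
rewrite doubleS !big_ord_recr IH /= -/(uphalf i.*2.+1) uh uphalf_double ?doubleK.
rewrite exprS -signr_odd odd_double expr0 mulr1 expr1z exprN1.
rewrite invrZ ?unitfE// -mulrA -scalerAl mul1r -scalerAl -scalerAr divrr//.
by rewrite !scalerA divfK.
Qed.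

(** For even [s] the scalars telescope to [u 0 / u s./2]; for odd [s] the
leftover quotient is cancelled by the last, unpaired, factor. *)
Lemma prod_chain_eq1 (F : fieldType) (M : unitAlgType F) (u : nat -> F) (P : nat -> M) (s : nat) :
  (forall j, u j != 0) -> (forall j, P j \is a GRing.unit) ->
  u 0%N = 1 -> (if odd s then P s./2 = 1 else u s./2 = 1) ->
  \prod_(l < s) (u (uphalf l) *: P l./2) ^ ((-1) ^+ l : int) = 1.
Proof.
move=> u_neq0 uP u0 last; rewrite -(odd_double_half s).
case: (odd s) last => [Pm|um]; last by rewrite prod_telescope// u0 um divr1 scale1r.
rewrite add1n big_ord_recr prod_telescope//= uphalf_double doubleK Pm u0.
by rewrite -signr_odd odd_double expr0 expr1z -scalerAl !mul1r scalerA mulVf// scale1r.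
Qed.

(** * A chain of matrices linked by primes *)

(** Euclid: a prime factor of n! + 1 exceeds n. *)
Definition next_prime (n : nat) : nat := pdiv n`!.+1.

Lemma next_prime_gt n : (n < next_prime n)%N.
Proof.
have p_prime : prime (next_prime n) by apply: pdiv_prime; rewrite ltnS fact_gt0.
rewrite ltnNge; apply/negP => le_pn.
have := pdiv_dvd n`!.+1; rewrite -/(next_prime n) -addn1 dvdn_addr; last first.
  by rewrite dvdn_fact// prime_gt0.
by rewrite dvdn1 => /eqP p1; rewrite p1 in p_prime.
Qed.

Definition prime_seq (j : nat) : nat := iter j.+1 next_prime 0%N.

Lemma prime_seq_prime j : prime (prime_seq j).
Proof. by apply: pdiv_prime; rewrite ltnS fact_gt0. Qed.

Lemma prime_seq_inj : injective prime_seq.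
Proof.
have incr : {homo prime_seq : i j / (i < j)%N}.
  by apply: (homo_ltn ltn_trans) => j; exact: next_prime_gt.
by move=> i j eq_ij; have [/incr|/incr|//] := ltngtP i j; rewrite eq_ij ltnn.
Qed.

Definition modulus (s : nat) : nat := (\prod_(j < s) prime_seq j)%N.

Lemma modulus_gt0 s : (0 < modulus s)%N.
Proof. by apply: prodn_gt0 => j; exact: prime_gt0 (prime_seq_prime j). Qed.

Lemma prime_seq_dvd s j : (j < s)%N -> (prime_seq j %| modulus s)%N.
Proof. by move=> lt_js; rewrite /modulus (bigD1 (Ordinal lt_js))//= dvdn_mulr. Qed.

(** The scalars u_i: the prime linking [i.*2.-1] and [i.*2], or 1 if one of these
two positions does not exist. *)
Definition link_scale (s i : nat) : nat :=
  if (0 < i.*2 < s)%N then prime_seq i.*2.-1 else 1%N.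

(** The diagonal entries of all the blocks in a row: the block of index [i] has
the entries [i.*2] and [i.*2.+1].  Modulo every prime in use, the even ones are
the prime linking [i.*2] and [i.*2.+1], and the odd ones are 1.  For odd [s] the
last block is unpaired, and is the identity matrix. *)
Definition block_entry (s : nat) (x : nat -> nat) (j : nat) : nat :=
  if (j < s./2.*2)%N then ((if odd j then 1 else prime_seq j) + modulus s * x j)%N
  else 1%N.

Definition block (s : nat) (x : nat -> nat) (i : nat) : 'M[int]_2 :=
  diag_mx (\row_b (block_entry s x (i.*2 + b))%:Z).

Definition chain_mx (s : nat) (x : nat -> nat) (l : nat) : 'M[int]_2 :=
  (link_scale s (uphalf l))%:Z *: block s x l./2.

Lemma link_scale_gt0 s i : (0 < link_scale s i)%N.
Proof. by rewrite /link_scale; case: ifP => // _; exact: prime_gt0 (prime_seq_prime _). Qed.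

Lemma link_scale_le s i : (link_scale s i <= modulus s)%N.
Proof.
rewrite /link_scale; case: ifP => [lt_is|_]; last exact: modulus_gt0.
by apply: dvdn_leq (modulus_gt0 s) _; apply: prime_seq_dvd; lia.
Qed.

Lemma logn_link_scale s i j :
  logn (prime_seq j) (link_scale s i) = (0 < i.*2 < s)%N && (i.*2 == j.+1) :> nat.
Proof.
rewrite /link_scale; case: ifP => [lt_is|_]; last by rewrite logn1.
rewrite logn_prime ?prime_seq_prime// (inj_eq prime_seq_inj).
by congr nat_of_bool; lia.
Qed.

Lemma block_entry_gt0 s x j : (0 < block_entry s x j)%N.
Proof.
rewrite /block_entry; case: ifP => // _; rewrite addn_gt0; case: ifP => //= _.
by rewrite prime_gt0// prime_seq_prime.
Qed.

Lemma prime_seq_dvd_block_entry s x j k : (j < s)%N ->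
  (prime_seq j %| block_entry s x k)%N = [&& k == j, ~~ odd k & (k < s./2.*2)%N].
Proof.
move=> lt_js; rewrite /block_entry.
have N1 : (prime_seq j %| 1)%N = false.
  by rewrite dvdn1; apply/negbTE; rewrite gtn_eqF// prime_gt1// prime_seq_prime.
case: ifP => [lt_k|_]; last by rewrite N1 !andbF.
rewrite dvdn_addl ?dvdn_mulr ?prime_seq_dvd//.
case: ifP => _; first by rewrite N1 andbF.
by rewrite dvdn_prime2 ?prime_seq_prime// (inj_eq prime_seq_inj) eq_sym !andbT.
Qed.

Lemma logn_block_entry s x j k : (j < s)%N ->
  logn (prime_seq j) (block_entry s x k) =
  (logn (prime_seq j) (block_entry s x j) * [&& k == j, ~~ odd k & (k < s./2.*2)%N])%N.
Proof.
move=> lt_js; rewrite -(prime_seq_dvd_block_entry x k lt_js).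
have [dvd_k|ndvd_k] := boolP (_ %| _)%N.
  move: dvd_k; rewrite prime_seq_dvd_block_entry// => /andP[/eqP -> _].
  by rewrite muln1.
by rewrite muln0; apply/eqP; rewrite -leqn0 leqNgt logn_gt0 mem_primes (negPf ndvd_k) !andbF.
Qed.

Lemma absz_det_chain_mx s x l :
  `|\det (chain_mx s x l)|%N = (link_scale s (uphalf l) ^ 2 *
    (block_entry s x l./2.*2 * block_entry s x l./2.*2.+1))%N.
Proof.
by rewrite /chain_mx detZ det_diag !big_ord_recl big_ord0 !mxE mulr1 /= addn0 addn1 mulnn.
Qed.

Lemma det_chain_mx_neq0 s x l : \det (chain_mx s x l) != 0.
Proof.
by rewrite -absz_gt0 absz_det_chain_mx !muln_gt0 ?expn_gt0 link_scale_gt0 !block_entry_gt0.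
Qed.

(** The hypothesis of [path_min_dependent] for the chain: a link with [j] odd
comes from the scalars, hence the valuation 2 in a determinant of size 2; a
link with [j] even comes from a block. *)
Lemma logn_det_chain_mx s x j : (j.+1 < s)%N ->
  exists2 w, (0 < w)%N & forall l, (l < s)%N ->
    logn (prime_seq j) `|\det (chain_mx s x l)| = (w * ((l == j) || (l == j.+1)))%N.
Proof.
move=> lt_js; have lt_js' := ltnW lt_js.
have lognE l : logn (prime_seq j) `|\det (chain_mx s x l)| =
    (2 * ((0 < (uphalf l).*2 < s) && ((uphalf l).*2 == j.+1)) +
     logn (prime_seq j) (block_entry s x j) *
       [&& l./2.*2 == j, ~~ odd j & (j < s./2.*2)])%N.
  rewrite absz_det_chain_mx !lognM ?muln_gt0 ?expn_gt0 ?link_scale_gt0 ?block_entry_gt0//.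
  rewrite addnn -mul2n logn_link_scale.
  rewrite (logn_block_entry x l./2.*2 lt_js') (logn_block_entry x l./2.*2.+1 lt_js').
  rewrite /= odd_double /= andbF muln0 addn0; congr (_ + _ * nat_of_bool _)%N.
  by lia.
have [odd_j|even_j] := boolP (odd j).
  exists 2%N => // l lt_ls; rewrite lognE odd_j andbF muln0 addn0.
  by congr (_ * nat_of_bool _)%N; lia.
exists (logn (prime_seq j) (block_entry s x j)).
  rewrite logn_gt0 mem_primes prime_seq_prime block_entry_gt0.
  by rewrite prime_seq_dvd_block_entry// eqxx even_j /=; lia.
move=> l lt_ls; rewrite lognE even_j.
have -> : ((uphalf l).*2 == j.+1) = false by lia.
by rewrite andbF muln0 add0n; congr (_ * nat_of_bool _)%N; lia.
Qed.

(** * The tuples of the chain are minimally dependent *)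

Lemma chain_mx_dependent s x : (0 < s)%N ->
  mult_dependent (fun l : 'I_s => chain_mx s x l).
Proof.
move=> s_gt0; exists (fun l : 'I_s => (-1) ^+ l); split.
  by exists (Ordinal s_gt0); rewrite expr0.
pose u i : rat := (link_scale s i)%:R.
pose P i : 'M[rat]_2 := map_mx intr (block s x i).
transitivity (\prod_(l < s) (u (uphalf l) *: P l./2) ^ ((-1) ^+ l : int)).
  by apply: eq_bigr => l _; rewrite /chain_mx map_mxZ.
apply: prod_chain_eq1 => [j|j||].
- by rewrite pnatr_eq0 -lt0n link_scale_gt0.
- rewrite -[_ \is a _]/(_ \in unitmx) unitmxE det_map_mx unitfE intr_eq0 det_diag.
  by apply/prodf_neq0 => b _; rewrite mxE; have := block_entry_gt0 s x (j.*2 + b); lia.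
- by [].
case: ifP => odd_s; last by rewrite /u /link_scale; case: ifP => //; lia.
rewrite /P.
have -> : block s x s./2 = 1.
  rewrite /block -[1]diag_const_mx; congr diag_mx.
  by apply/rowP => b; rewrite !mxE /block_entry ltnNge leq_addr.
by rewrite map_mx1.
Qed.

Lemma chain_mx_min_dependent s x : (0 < s)%N ->
  min_mult_dependent (fun l : 'I_s => chain_mx s x l).
Proof.
move=> s_gt0; apply: (@path_min_dependent _ _ prime_seq).
- by move=> l; exact: det_chain_mx_neq0.
- move=> j lt_js; have [w w_gt0 wE] := logn_det_chain_mx x lt_js.
  by exists w => // l; exact: wE.
- exact: chain_mx_dependent.
Qed.

(** * Counting *)

Lemma height_chain_mx s x N l : (0 < N)%N -> (forall j, x j < N)%N ->
  (height (chain_mx s x l) <= modulus s ^ 2 * N)%N.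
Proof.
move=> N_gt0 ltxN; have Q_gt0 := modulus_gt0 s.
rewrite /height geq_max muln_gt0 expn_gt0 Q_gt0 N_gt0.
apply/bigmax_leqP => a _; apply/bigmax_leqP => b _.
rewrite !mxE; case: (a == b); last by rewrite mulr0n mulr0.
rewrite mulr1n abszM !absz_nat expnS expn1 -mulnA leq_mul ?link_scale_le//.
rewrite /block_entry; case: ifP => [lt_j|_]; last by rewrite muln_gt0 Q_gt0.
apply: (@leq_trans (modulus s * (x (l./2.*2 + a)).+1)); last by rewrite leq_mul2l ltxN orbT.
rewrite mulnS leq_add2r; case: ifP => // _.
by apply: dvdn_leq => //; apply: prime_seq_dvd; lia.
Qed.

(** The parameter [x j] is read off from a diagonal entry of the [j]-th matrix. *)
Lemma chain_mx_inj s x y : (forall l, (l < s)%N -> chain_mx s x l = chain_mx s y l) ->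
  forall j, (j < s./2.*2)%N -> x j = y j.
Proof.
move=> eqxy j lt_j; have lt_js : (j < s)%N by lia.
have := congr1 (fun A : 'M_2 => A (inord (odd j)) (inord (odd j))) (eqxy j lt_js).
rewrite !mxE eqxx !mulr1n inordK; last by case: (odd j).
rewrite -!PoszM addnC odd_double_half /block_entry lt_j => -[/eqP].
rewrite eqn_mul2l gtn_eqF ?link_scale_gt0//= eqn_add2l.
by rewrite eqn_mul2l gtn_eqF ?modulus_gt0//= => /eqP.
Qed.

Lemma num_sym_star_ge (R : realType) (s N : nat) (c H : R) :
  (0 < s)%N -> (0 < N)%N -> (modulus s ^ 2 * N)%:R <= c * H ->
  (N ^ s./2.*2 <= num_sym_star s c H)%N.
Proof.
move=> s_gt0 N_gt0 leQN.
pose x (f : {ffun 'I_s./2.*2 -> 'I_N}) j : nat := oapp (fun i => nat_of_ord (f i)) 0%N (insub j).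
pose F f : s.-tuple 'M[int]_2 := [tuple chain_mx s (x f) l | l < s].
have x_lt f j : (x f j < N)%N by rewrite /x; case: insub => [i|] /=.
have F_inj : injective F.
  move=> f g eqFG; apply/ffunP => i; apply: val_inj => /=.
  have eqA l : (l < s)%N -> chain_mx s (x f) l = chain_mx s (x g) l.
    by move=> ltl; have := congr1 (fun t => tnth t (Ordinal ltl)) eqFG; rewrite !tnth_mktuple.
  by have := chain_mx_inj eqA (ltn_ord i); rewrite /x !valK.
have -> : (N ^ s./2.*2 = #|` [fset F f | f in {: {ffun 'I_s./2.*2 -> 'I_N}}]|)%N%fset.
  by rewrite card_imfset//= -cardE card_ffun !card_ord.
rewrite /num_sym_star; apply/fsubset_leq_card/fsubsetP => A /imfsetP[f _ ->].
rewrite in_fset_set; last exact: finite_sym_star.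
rewrite inE; split.
  move=> l; rewrite tnth_mktuple; split.
  - by rewrite linearZ /= tr_diag_mx.
  - exact: det_chain_mx_neq0.
  - by apply: le_trans leQN; rewrite ler_nat height_chain_mx.
have -> : tnth (F f) = (fun l : 'I_s => chain_mx s (x f) l).
  by apply/funext => l; rewrite tnth_mktuple.
exact: chain_mx_min_dependent.
Qed.

(** Apply [num_sym_star_ge] with [N] the integral part of [c H / Q ^ 2], which is
at least half of that number once it is at least 1. *)
Lemma num_sym_star_asymp (R : realType) (s : nat) (c : R) : (0 < s)%N -> 0 < c ->
  exists C H0 : R, [/\ 0 < C, 1 <= H0 &
    forall H, H0 <= H -> C * H ^+ s./2.*2 <= (num_sym_star s c H)%:R].
Proof.
move=> s_gt0 c_gt0; pose K : R := (modulus s ^ 2)%:R.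
have K_gt0 : 0 < K by rewrite ltr0n expn_gt0 modulus_gt0.
exists ((c / (2 * K)) ^+ s./2.*2), (Num.max 1 (K / c)); split.
- by rewrite exprn_gt0// divr_gt0// mulr_gt0.
- by rewrite le_max lexx.
move=> H; rewrite ge_max => /andP[H_ge1]; rewrite ler_pdivrMr// mulrC => leK.
pose N := Num.truncn (c * H / K).
have cHK_ge1 : 1 <= c * H / K by rewrite ler_pdivlMr// mul1r.
have N_gt0 : (0 < N)%N by rewrite truncn_gt0.
have N_ge1 : 1 <= N%:R :> R by rewrite ler1n.
have /andP[leN ltN] := truncn_itv (le_trans ler01 cHK_ge1).
have leQN : (modulus s ^ 2 * N)%:R <= c * H by rewrite natrM mulrC -ler_pdivlMr.
apply: (@le_trans _ _ ((N ^ s./2.*2)%:R)); last first.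
  by rewrite ler_nat; exact: num_sym_star_ge.
rewrite natrX -exprMn; apply: lerXn2r.
- by rewrite nnegrE mulr_ge0 ?divr_ge0 ?mulr_ge0 ?ltW// (lt_le_trans ltr01).
- by rewrite nnegrE.
have -> : c / (2 * K) * H = c * H / K / 2 by rewrite invfM; ring.
rewrite ler_pdivrMr//; apply: le_trans (ltW ltN) _.
by rewrite -natr1 mulr_natr mulr2n lerD2l.
Qed.

Theorem proposition26 (R : realType) (s : nat) (hs : (1 <= s)%N)
    (c : R) (hc : 0 < c) :
  (~~ odd s ->
     forall eps : R, 0 < eps ->
     exists C H0 : R, [/\ 0 < C, 0 < H0 &
       forall H : R, H0 <= H ->
         C * H `^ (s%:R - eps) <= (num_sym_star s c H)%:R]) /\
  (odd s ->
     exists C H0 : R, [/\ 0 < C, 0 < H0 &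
       forall H : R, H0 <= H ->
         C * H ^+ (s - 1) <= (num_sym_star s c H)%:R]).
Proof.
have [C [H0 [C_gt0 H0_ge1 numE]]] := num_sym_star_asymp hs hc.
have H0_gt0 : 0 < H0 := lt_le_trans ltr01 H0_ge1.
split=> [even_s eps eps_gt0|odd_s]; exists C, H0; split=> // H leH; last first.
  by have := numE H leH; rewrite (_ : s./2.*2 = (s - 1)%N)//; lia.
apply: le_trans (numE H leH); rewrite ler_pM2l//.
have -> : s./2.*2 = s by lia.
rewrite -powR_mulrn; last by rewrite (le_trans _ leH)// ltW.
by apply: ler_powR; [exact: le_trans leH|rewrite gerBl ltW].
Qed.
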